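(* Let $(L,\cdot)$ be a commutative associative algebra and $(L,[\;,\;])$ be a Lie algebra on the same vector space $L$. Then $(L,\cdot,[\;,\;])$ is both a Poisson algebra and a transposed Poisson algebra if and only if $$x\cdot[y,z]=[x\cdot y,z]=0,\quad\forall x,y,z\in L.$$
   Context: All vector spaces are over a field $K$ of characteristic zero. Commutative associative algebras are not assumed unital. A Poisson algebra is a triple $(L,\cdot,[\;,\;])$ where $(L,\cdot)$ is a commutative associative algebra, $(L,[\;,\;])$ is a Lie algebra, and $[x,y\cdot z]=[x,y]\cdot z+y\cdot[x,z]$ for all $x,y,z\in L$. A transposed Poisson algebra is a triple $(L,\cdot,[\;,\;])$ where $(L,\cdot)$ is a commutative associative algebra, $(L,[\;,\;])$ is a Lie algebra, and $2z\cdot[x,y]=[z\cdot x,y]+[x,z\cdot y]$ for all $x,y,z\in L$. *)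

(* Defs.v *)
From HB Require Import structures.
From mathcomp Require Import all_boot all_order all_algebra.

Set Implicit Arguments.
Unset Strict Implicit.
Unset Printing Implicit Defensive.

Import GRing.Theory.
Local Open Scope ring_scope.

(* Products are plain functions on an arbitrary lmodType rather than a ring
   structure: the algebras are neither unital nor finite-dimensional, and a
   single space carries both products. *)

Record comm_assoc_algebra (K : fieldType) (L : lmodType K)
    (mul : L -> L -> L) : Prop := CommAssocAlgebra {
  caa_bilinear : bilinear_for *:%R *:%R mul;
  caa_mulA : associative mul;
  caa_mulC : commutative mul
}.

Record lie_algebra (K : fieldType) (L : lmodType K)
    (br : L -> L -> L) : Prop := LieAlgebra {
  lie_bilinear : bilinear_for *:%R *:%R br;
  lie_alternating : forall x, br x x = 0;
  lie_jacobi : forall x y z,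
    br x (br y z) + br y (br z x) + br z (br x y) = 0
}.

Record poisson_algebra (K : fieldType) (L : lmodType K)
    (mul br : L -> L -> L) : Prop := PoissonAlgebra {
  poisson_comm_assoc : comm_assoc_algebra mul;
  poisson_lie : lie_algebra br;
  poisson_leibniz : forall x y z,
    br x (mul y z) = mul (br x y) z + mul y (br x z)
}.

Record transposed_poisson_algebra (K : fieldType) (L : lmodType K)
    (mul br : L -> L -> L) : Prop := TransposedPoissonAlgebra {
  tpoisson_comm_assoc : comm_assoc_algebra mul;
  tpoisson_lie : lie_algebra br;
  tpoisson_leibniz : forall x y z,
    2%:R *: mul z (br x y) = br (mul z x) y + br x (mul z y)
}.

(* Main.v *)
Require Import Defs.
From HB Require Import structures.
From mathcomp Require Import all_boot all_order all_algebra.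
Import GRing.Theory.
Local Open Scope ring_scope.

(** Write T(x, y, z) for x . [y, z].  Expanding both brackets on the right of
    the transposed Leibniz rule by the ordinary Leibniz rule leaves
    x . [z, y] + y . [x, z] = 0, so T is symmetric in its first two arguments
    ([mul_br_swap]).  It is also antisymmetric in its last two, and any map
    with both symmetries satisfies T = - T ([symm_antisymm_eq0]), hence
    vanishes in characteristic zero.  The Leibniz rule then gives
    [x . y, z] = 0.  Conversely, if all mixed products vanish, then every term
    of the two compatibility rules is zero. *)

Lemma lmod_addrr_eq0 {K : fieldType} (charK0 : [pchar K] =i pred0)
    {L : lmodType K} (v : L) : v + v = 0 -> v = 0.
Proof.
have two_neq0 : 2%:R != 0 :> K by rewrite (pcharf0P _).1.
move=> vv0; apply: (scalerI two_neq0).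
by rewrite scaler0 scaler_nat mulr2n.
Qed.

(** The transpositions (1 2) and (2 3) generate the symmetric group on three
    letters and are conjugate in it, so they cannot act on [t] by different
    signs unless [t = - t]. *)
Lemma symm_antisymm_eq0 {K : fieldType} (charK0 : [pchar K] =i pred0)
    {T : Type} {L : lmodType K} {t : T -> T -> T -> L} :
  (forall x y z, t x y z = t y x z) -> (forall x y z, t x y z = - t x z y) ->
  forall x y z, t x y z = 0.
Proof.
move=> tS tA x y z; apply: (lmod_addrr_eq0 charK0).
(* Going around the whole orbit of (x, y, z) crosses three sign changes. *)
by rewrite {1}(tS x y z) (tA y x z) (tS y z x) (tA z y x) opprK
  (tS z x y) (tA x z y) addNr.
Qed.

Lemma bilinearDl {K : fieldType} {L : lmodType K} {f : L -> L -> L}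
    (fB : bilinear_for *:%R *:%R f) x y z : f (x + y) z = f x z + f y z.
Proof. by have := fB.1 z 1 x y; rewrite /= !scale1r. Qed.

Lemma bilinearDr {K : fieldType} {L : lmodType K} {f : L -> L -> L}
    (fB : bilinear_for *:%R *:%R f) x y z : f x (y + z) = f x y + f x z.
Proof. by have := fB.2 x 1 y z; rewrite /= !scale1r. Qed.

Lemma bilinearNr {K : fieldType} {L : lmodType K} {f : L -> L -> L}
    (fB : bilinear_for *:%R *:%R f) x y : f x (- y) = - f x y.
Proof.
have fx0 : f x 0 = 0 by apply: (addrI (f x 0)); rewrite -(bilinearDr fB) !addr0.
by apply/eqP; rewrite -addr_eq0 -(bilinearDr fB) addNr fx0.
Qed.

Lemma lie_anticomm {K : fieldType} {L : lmodType K} {br : L -> L -> L} :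
  lie_algebra br -> forall x y, br x y = - br y x.
Proof.
move=> [brB br_alt _] x y; apply/eqP; rewrite -addr_eq0.
have := br_alt (x + y).
by rewrite (bilinearDl brB) !(bilinearDr brB) !br_alt add0r addr0 => ->.
Qed.

Lemma mul_br_swap {K : fieldType} {L : lmodType K} {mul br : L -> L -> L} :
  poisson_algebra mul br -> transposed_poisson_algebra mul br ->
  forall x y z, mul x (br y z) = mul y (br x z).
Proof.
move=> [[mulB _ mulC] br_lie leib] [_ _ tleib] x y z.
have brC := lie_anticomm br_lie.
have := tleib x y z.
rewrite (brC (mul z x) y) !leib (mulC (br y z)) (mulC (br x z)).
rewrite (brC y x) (bilinearNr mulB) opprB [mul y _ + _]addrC addrACA.
rewrite scaler_nat mulr2n -[LHS]addr0 => /addrI/esym.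
by move/eqP; rewrite addrC subr_eq0 => /eqP.
Qed.

Theorem proposition2p11 (K : fieldType) (charK0 : [pchar K] =i pred0)
    (L : lmodType K) (mul br : L -> L -> L)
    (mul_caa : comm_assoc_algebra mul) (br_lie : lie_algebra br) :
  (poisson_algebra mul br /\ transposed_poisson_algebra mul br) <->
  (forall x y z : L, mul x (br y z) = 0 /\ br (mul x y) z = 0).
Proof.
have [mulB _ mulC] := mul_caa.
have brC := lie_anticomm br_lie.
split=> [[pois tpois] x y z | mix0].
  have mul_br0 u v w : mul u (br v w) = 0.
    apply: (symm_antisymm_eq0 charK0 (t := fun u v w => mul u (br v w))).
      exact: mul_br_swap.
    by move=> u' v' w'; rewrite -(bilinearNr mulB) -brC.
  split=> //; rewrite brC (poisson_leibniz pois) mulC !mul_br0.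
  by rewrite addr0 oppr0.
have mul_br0 u v w : mul u (br v w) = 0 by have [] := mix0 u v w.
have br_mul0 u v w : br (mul u v) w = 0 by have [] := mix0 u v w.
split; split=> // x y z; rewrite [br x (mul _ _)]brC ?(mulC (br x y));
  by rewrite !(mul_br0, br_mul0) oppr0 ?scaler0 addr0.
Qed.
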